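(* The semidefinite program $\mathrm{SDP}_2$ (the symmetry-reduced QAP relaxation of the traveling salesman problem defined in the context) is non-monotonic: there exist $N<N'$ and TSP instances $D\in\mathbb{R}^{N\times N}$ and $D'\in\mathbb{R}^{N'\times N'}$ (both symmetric and metric) such that $D$ is the principal submatrix $D'[S]$ of $D'$ on some set $S$ of $N$ vertices (up to relabeling of vertices), and $$\mathrm{OPT}_{\mathrm{SDP}_2}(D')<\mathrm{OPT}_{\mathrm{SDP}_2}(D).$$
   Context: TSP: an instance on $N\ge 3$ vertices is a symmetric matrix $D=(d_{ij})\in\mathbb{R}^{N\times N}$ with $d_{ij}\ge 0$, $d_{ii}=0$ and $d_{ij}\le d_{ik}+d_{kj}$ for all $i,j,k$ (distinct vertices may be at distance $0$). Non-monotonic means that adding vertices to an instance, in a way that keeps the edge costs symmetric and metric and leaves costs between the original vertices unchanged, can strictly decrease the optimal value. Notation: $[m]=\{1,\dots,m\}$; $I_m$, $J_m$ are the $m\times m$ identity and all-ones matrices; $E^{(m)}_{jj}$ is the $m\times m$ matrix with a single $1$ in position $(j,j)$; $\mathbb{S}^{m\times m}$ is the set of real symmetric $m\times m$ matrices; $M[S,T]$ is the submatrix of $M$ with rows in $S$ and columns in $T$, and $M[S]=M[S,S]$; $\mathrm{Diag}(x)$ is the diagonal matrix with diagonal $x$; $\mathrm{vec}(M)$ stacks the columns of $M$; $\otimes$ is the Kronecker product; $Y\ge 0$ is entrywise nonnegativity and $Y\succeq 0$ is positive semidefiniteness. $C^{(N)}_1$ is the adjacency matrix of the $N$-cycle on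 $[N]$ with edges $\{i,i+1\}$ and $\{N,1\}$. $\mathrm{SDP}_2$: for an $N$-vertex instance $D$, put $n=N-1$, fix $r,s\in[n+1]$, and let $\alpha=[n+1]\setminus\{r\}$, $\beta=[n+1]\setminus\{s\}$, $\bar c=\mathrm{vec}\big(C^{(n+1)}_1[\alpha,\{r\}]\,D[\{s\},\beta]\big)\in\mathbb{R}^{n^2}$. Then $\mathrm{OPT}_{\mathrm{SDP}_2}(D)$ is the minimum of $$\mathrm{trace}\Big(\big(D[\beta]\otimes \tfrac12 C^{(n+1)}_1[\alpha]+\mathrm{Diag}(\bar c)\big)Y\Big)$$ over $Y\in\mathbb{S}^{n^2\times n^2}$ with $Y\ge 0$, $Y\succeq 0$ and (i) $\mathrm{trace}((I_n\otimes E^{(n)}_{jj})Y)=1$ for $j=1,\dots,n$; (ii) $\mathrm{trace}((E^{(n)}_{jj}\otimes I_n)Y)=1$ for $j=1,\dots,n$; (iii) $\mathrm{trace}\big((I_n\otimes(J_n-I_n)+(J_n-I_n)\otimes I_n)Y\big)=0$; (iv) $\mathrm{trace}((J_n\otimes J_n)Y)=n^2$. The choice of $r,s$ for each $N$ is arbitrary but fixed (one may take $r=s=1$). *)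

(* Defs.v *)
From HB Require Import structures.
From mathcomp Require Import all_boot all_order all_algebra.
From mathcomp Require Import mxtens.
From mathcomp Require Import all_classical reals.

Set Implicit Arguments.
Unset Strict Implicit.
Unset Printing Implicit Defensive.

Import Order.TTheory GRing.Theory Num.Theory.

Local Open Scope classical_set_scope.
Local Open Scope ring_scope.

Definition tsp_instance (R : realType) (N : nat) (D : 'M[R]_N) : Prop :=
  [/\ (3 <= N)%N,
      D^T = D,
      forall i j, 0 <= D i j,
      forall i, D i i = 0
    & forall i j k, D i j <= D i k + D k j].

(* [ordS] is the cyclic successor, so this also covers the closing edge. *)
Definition cycle_adj (R : realType) (N : nat) : 'M[R]_N :=
  \matrix_(i < N, j < N) ((ordS i == j) || (ordS j == i))%:R.

(* Column stacking: entry (i, j) of an m x p matrix has position j * m + i,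
   the same indexing as in the Kronecker product [*t].  The library's [mxvec]
   stacks rows instead. *)
Definition colvec (R : realType) (m p : nat) (M : 'M[R]_(m, p)) :
    'rV[R]_(p * m) :=
  \row_k M (mxtens_unindex k).2 (mxtens_unindex k).1.

Definition psd (R : realType) (m : nat) (Y : 'M[R]_m) : Prop :=
  forall x : 'cV[R]_m, 0 <= (x^T *m Y *m x) 0 0.

Section SDP2.

Context (R : realType) (n : nat).

Local Notation In := (1%:M : 'M[R]_n).
Local Notation Jn := (const_mx 1 : 'M[R]_n).
Local Notation En j := (delta_mx j j : 'M[R]_n).

Definition SDP2_feasible : set 'M[R]_(n * n) := [set Y |
  [/\ Y^T = Y, forall k l, 0 <= Y k l & psd Y] /\
  [/\ forall j : 'I_n, \tr ((In *t En j) *m Y) = 1,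
      forall j : 'I_n, \tr ((En j *t In) *m Y) = 1,
      \tr ((In *t (Jn - In) + (Jn - In) *t In) *m Y) = 0
    & \tr ((Jn *t Jn) *m Y) = n%:R ^+ 2]].

(* Deleting row and column r is the restriction to [n+1] \ {r}, so
   [row' r (col' r C)] is C[alpha] and [row' r (col r C)] is C[alpha, {r}];
   likewise for D, s and beta. *)
Definition SDP2_cbar (r s : 'I_n.+1) (D : 'M[R]_n.+1) : 'rV[R]_(n * n) :=
  colvec (row' r (col r (cycle_adj R n.+1)) *m row s (col' s D)).

Definition SDP2_cost (r s : 'I_n.+1) (D : 'M[R]_n.+1) : 'M[R]_(n * n) :=
  row' s (col' s D) *t (2^-1 *: row' r (col' r (cycle_adj R n.+1)))
  + diag_mx (SDP2_cbar r s D).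

Definition SDP2_values (r s : 'I_n.+1) (D : 'M[R]_n.+1) : set R :=
  [set \tr (SDP2_cost r s D *m Y) | Y in SDP2_feasible].

Definition is_OPT_SDP2 (r s : 'I_n.+1) (D : 'M[R]_n.+1) (v : R) : Prop :=
  SDP2_values r s D v /\ lbound (SDP2_values r s D) v.

End SDP2.

(* Main.v *)
(* The larger instance is the cut metric of a partition of seven vertices into
   classes of sizes 4 and 3 (distance 0 inside a class, 1 across); the smaller
   one is a triangle of perimeter 2 in it.  On three vertices every feasible Y
   has value equal to the perimeter.  On seven, fix the vertex s of the class
   of size 4 at position r; three vertices of each class remain.  If M is a
   matrix that passes for the pair moments E[xi_p xi_q] of the indicator xi of
   the positions occupied by the class of s, then spreading M uniformly over
   the vertices of each class gives a feasible Y, even when M does not come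
   from a random set of positions.  The objective depends on M only through
   the expected number of edges of the cycle between the classes, which is at
   least 2 for a random set, but 7/4 for the matrix [six_moments].  Minima
   exist because the feasible set is compact. *)

Require Import Defs.
From mathcomp Require Import all_boot all_order all_algebra.
From mathcomp Require Import mxtens.
From mathcomp Require Import all_classical reals.
From mathcomp Require Import topology normedtype derive.
From mathcomp Require Import ring lra.

Set Implicit Arguments.
Unset Strict Implicit.
Unset Printing Implicit Defensive.

Import Order.TTheory GRing.Theory Num.Theory.
Import numFieldNormedType.Exports.

Local Open Scope classical_set_scope.
Local Open Scope ring_scope.

(** * Sums and traces over Kronecker indices *)

Section Tensor.

Lemma sum_mxtens (V : nmodType) m n (F : 'I_(m * n) -> V) :
  \sum_k F k = \sum_i \sum_j F (mxtens_index (i, j)).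
Proof.
rewrite pair_bigA (reindex (@mxtens_index m n)) /=; last first.
  exists (@mxtens_unindex m n) => k _; first exact: mxtens_indexK.
  exact: mxtens_unindexK.
by apply: eq_bigr => -[i j].
Qed.

Lemma trace_mulmxE (R : pzRingType) n (A B : 'M[R]_n) :
  \tr (A *m B) = \sum_i \sum_j A i j * B j i.
Proof. by apply: eq_bigr => i _; rewrite mxE. Qed.

Lemma trace_tens_mulmx (R : pzRingType) m n (A : 'M[R]_m) (B : 'M[R]_n)
    (Y : 'M[R]_(m * n)) :
  \tr ((A *t B) *m Y) =
  \sum_u \sum_p \sum_v \sum_q
    A u v * B p q * Y (mxtens_index (v, q)) (mxtens_index (u, p)).
Proof.
rewrite trace_mulmxE sum_mxtens; apply: eq_bigr => u _; apply: eq_bigr => p _.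
rewrite sum_mxtens; apply: eq_bigr => v _; apply: eq_bigr => q _.
by rewrite tensmxE.
Qed.

Lemma sum_delta (R : realType) n (i : 'I_n) (F : 'I_n -> R) :
  \sum_j (i == j)%:R * F j = F i.
Proof.
rewrite (bigD1 i) //= eqxx mul1r big1 ?addr0 // => j.
by rewrite eq_sym => /negPf ->; rewrite mul0r.
Qed.

End Tensor.

(** Here [u], [v] index vertices (rows of the distance matrix) and [p], [q] positions on the cycle.
    For an actual tour the entry is 1 exactly when [u] sits at [p] and [v] at [q]. *)
Local Notation ent Y u p v q :=
  (Y (mxtens_index (u, p)) (mxtens_index (v, q))).

(** * Feasibility in terms of entries *)

Section Feasible.
Variables (R : realType) (n : nat).
Implicit Type Y : 'M[R]_(n * n).

(** Each trace unfolds to a sum of entries. As [Y] is nonnegative, the single equation (iii) forces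
    every entry occurring in it to vanish. *)
Lemma SDP2_feasibleP Y :
  SDP2_feasible Y <->
  [/\ Y^T = Y, forall k l, 0 <= Y k l & psd Y] /\
  [/\ forall p, \sum_u ent Y u p u p = 1,
      forall u, \sum_p ent Y u p u p = 1,
      forall u p v q, (u == v) != (p == q) -> ent Y u p v q = 0
    & \sum_k \sum_l Y k l = n%:R ^+ 2].
Proof.
have tr1 p : \tr ((1%:M *t delta_mx p p) *m Y) = \sum_u ent Y u p u p.
  rewrite trace_tens_mulmx; apply: eq_bigr => u _.
  rewrite -[RHS](sum_delta p (fun q => ent Y u q u q)).
  apply: eq_bigr => p' _.
  rewrite -[RHS](sum_delta u (fun v => _ * ent Y v p' u p')).
  apply: eq_bigr => v _.
  transitivity (\sum_q (p == q)%:R *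
                  ((u == v)%:R * (p == p')%:R * ent Y v q u p')).
    apply: eq_bigr => q _; rewrite !mxE andbC [q == p]eq_sym [p' == p]eq_sym.
    case: (p == q); case: (p == p');
      by rewrite /= ?(mul1r, mul0r, mulr0, mulr1).
  rewrite sum_delta -mulrA; congr (_ * _).
  by case: eqVneq => [->|]; rewrite ?mul0r.
have tr2 u : \tr ((delta_mx u u *t 1%:M) *m Y) = \sum_p ent Y u p u p.
  rewrite trace_tens_mulmx exchange_big /=; apply: eq_bigr => p _.
  rewrite -[RHS](sum_delta u (fun u' => ent Y u' p u' p)).
  apply: eq_bigr => u' _.
  transitivity (\sum_v (u == v)%:R * ((u == u')%:R * ent Y v p u' p)).
    apply: eq_bigr => v _.
    rewrite -[RHS](sum_delta p (fun q => _ * (_ * ent Y v q u' p))).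
    apply: eq_bigr => q _; rewrite !mxE andbC [v == u]eq_sym [u' == u]eq_sym.
    case: (u == v); case: (u == u'); case: (p == q);
      by rewrite /= ?(mul1r, mul0r, mulr0, mulr1).
  by rewrite sum_delta; case: eqVneq => [->|]; rewrite ?mul0r.
pose Jn := const_mx 1 : 'M[R]_n.
have tr3 : \tr ((1%:M *t (Jn - 1%:M) + (Jn - 1%:M) *t 1%:M) *m Y) =
    \sum_u \sum_p \sum_v \sum_q ((u == v) != (p == q))%:R * ent Y v q u p.
  rewrite mulmxDl mxtraceD !trace_tens_mulmx -big_split /=.
  apply: eq_bigr => u _; rewrite -big_split /=; apply: eq_bigr => p _.
  rewrite -big_split; apply: eq_bigr => v _ /=; rewrite -big_split /=.
  apply: eq_bigr => q _; rewrite !mxE -mulrDl.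
  by case: (u == v); case: (p == q); congr (_ * _) => /=; ring.
have tr4 : \tr ((Jn *t Jn) *m Y) = \sum_k \sum_l Y k l.
  rewrite trace_mulmxE exchange_big; apply: eq_bigr => k _.
  apply: eq_bigr => l _; rewrite -(mxtens_unindexK k) -(mxtens_unindexK l).
  case: (mxtens_unindex k) => u p; case: (mxtens_unindex l) => v q.
  by rewrite tensmxE !mxE !mul1r.
rewrite /SDP2_feasible /= -/Jn tr3 tr4; split.
  move=> [[YT Y0 Yp] [h1 h2 h3 h4]]; split; first by split.
  split=> //; [by move=> p; rewrite -tr1|by move=> u; rewrite -tr2|].
  move=> u p v q uvpq.
  have h0 u1 p1 v1 q1 : 0 <= ((u1 == v1) != (p1 == q1))%:R * ent Y v1 q1 u1 p1.
    by rewrite mulr_ge0.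
  (* A zero sum of nonnegative terms has zero terms, peeled off one index at a time. The order is
     [v], [q], [u], [p] because the trace produces the transposed entry. *)
  have e1 := psumr_eq0P (fun u1 _ => sumr_ge0 _ (fun p1 _ => sumr_ge0 _
    (fun v1 _ => sumr_ge0 _ (fun q1 _ => h0 u1 p1 v1 q1)))) h3 (i := v) isT.
  have e2 := psumr_eq0P (fun p1 _ => sumr_ge0 _
    (fun v1 _ => sumr_ge0 _ (fun q1 _ => h0 v p1 v1 q1))) e1 (i := q) isT.
  have e3 := psumr_eq0P
    (fun v1 _ => sumr_ge0 _ (fun q1 _ => h0 v q v1 q1)) e2 (i := u) isT.
  have := psumr_eq0P (fun q1 _ => h0 v q u q1) e3 (i := p) isT.
  by rewrite [v == u]eq_sym [q == p]eq_sym uvpq mul1r.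
move=> [[YT Y0 Yp] [h1 h2 h3 h4]]; split; first by split.
split=> //; [by move=> p; rewrite tr1|by move=> u; rewrite tr2|].
apply: big1 => u _; apply: big1 => p _; apply: big1 => v _; apply: big1 => q _.
case: (boolP ((u == v) != (p == q))) => uvpq; last by rewrite mul0r.
by rewrite h3 ?mulr0 // [v == u]eq_sym [q == p]eq_sym.
Qed.

End Feasible.

(** * Compactness and existence of minima *)

Section Attained.
Variables (R : realType) (n : nat).

Lemma continuous_trace_vec_mx (A : 'M[R]_n) :
  continuous (fun v : 'rV[R]_(n * n) => \tr (A *m vec_mx v)).
Proof.
have -> : (fun v : 'rV[R]_(n * n) => \tr (A *m vec_mx v)) =
    (fun v => \sum_i \sum_j A i j * v 0 (mxvec_index j i)).
  apply/funext => v; rewrite trace_mulmxE; apply: eq_bigr => i _.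
  by apply: eq_bigr => j _; rewrite mxE.
apply: continuous_big => [|i _]; first exact: add_continuous.
apply: continuous_big => [|j _]; first exact: add_continuous.
move=> v; apply: (@continuousM R); first exact: cst_continuous.
exact: coord_continuous.
Qed.

Lemma closed_trace_ge (A : 'M[R]_n) a :
  closed [set v : 'rV[R]_(n * n) | a <= \tr (A *m vec_mx v)].
Proof.
apply: (@closed_comp _ _ (fun v => \tr (A *m vec_mx v)) [set x | a <= x]).
  by move=> v _; exact: continuous_trace_vec_mx.
exact: closed_ge.
Qed.

Lemma closed_trace_eq (A : 'M[R]_n) a :
  closed [set v : 'rV[R]_(n * n) | \tr (A *m vec_mx v) = a].
Proof.
apply: (@closed_comp _ _ (fun v => \tr (A *m vec_mx v)) [set x | x = a]).
  by move=> v _; exact: continuous_trace_vec_mx.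
exact: closed_eq.
Qed.

End Attained.

Lemma closed_forall (T : topologicalType) (I : Type) (A : I -> set T) :
  (forall i, closed (A i)) -> closed [set x | forall i, A i x].
Proof.
move=> cA; rewrite (_ : mkset _ = \bigcap_(i in setT) A i).
  by apply: closed_bigI => i _.
by apply/seteqP; split=> x /= h i; [move=> _|]; exact: h.
Qed.

Lemma closed_and3 (T : topologicalType) (A B C : set T) :
  closed A -> closed B -> closed C -> closed [set x | [/\ A x, B x & C x]].
Proof.
move=> cA cB cC; rewrite (_ : mkset _ = A `&` B `&` C).
  by do 2 apply: closedI => //.
by apply/seteqP; split=> x [] => [//|[]].
Qed.

Lemma closed_and4 (T : topologicalType) (A B C D : set T) :
  closed A -> closed B -> closed C -> closed D ->
  closed [set x | [/\ A x, B x, C x & D x]].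
Proof.
move=> cA cB cC cD; rewrite (_ : mkset _ = A `&` B `&` C `&` D).
  by do 3 apply: closedI => //.
by apply/seteqP; split=> x [] => [//|[[]]].
Qed.

Lemma trace_delta_mulmx (R : pzRingType) n (A : 'M[R]_n) i j :
  \tr (delta_mx i j *m A) = A j i.
Proof.
rewrite trace_mulmxE (bigD1 i) //= (bigD1 j) //= mxE !eqxx mul1r.
rewrite !big1 ?addr0 // => k /negPf ki; last by rewrite mxE ki andbF mul0r.
by apply: big1 => l _; rewrite mxE ki mul0r.
Qed.

(** Bounded, since the entries are nonnegative with sum [n%:R ^+ 2]; closed, since every condition
    is a family of linear equations or inequalities. Symmetry is tested by traces against
    [delta_mx k l - delta_mx l k], semidefiniteness by traces against [x *m x^T]. *)
Lemma SDP2_feasible_compact (R : realType) n :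
  compact [set v : 'rV[R]_(n * n * (n * n)) | SDP2_feasible (vec_mx v)].
Proof.
apply: bounded_closed_compact.
  exists (n%:R ^+ 2); split=> [|b ltb v /= fv]; first exact: num_real.
  case/SDP2_feasibleP: fv => -[_ v0 _] [_ _ _ sumv].
  apply: le_trans (ltW ltb); rewrite [leLHS]mx_normrE.
  apply: bigmax_le => [|[i k] _]; first by rewrite exprn_ge0.
  rewrite /= ord1; case/mxvec_indexP: k => k l.
  have -> : v 0 (mxvec_index k l) = vec_mx v k l by rewrite mxE.
  rewrite ger0_norm ?v0 // -sumv (bigD1 k) //= (bigD1 l) //= -addrA lerDl.
  by rewrite addr_ge0 // sumr_ge0 // => k' _; rewrite ?sumr_ge0.
have cT : closed [set v : 'rV[R]_(n * n * (n * n)) | (vec_mx v)^T = vec_mx v].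
  rewrite (_ : mkset _ = [set v | forall k l,
      \tr ((delta_mx k l - delta_mx l k) *m vec_mx v) = 0]).
    by do 2 apply: closed_forall => ?; exact: closed_trace_eq.
  apply/seteqP; split=> v /= vT => [k l|].
    by rewrite mulmxBl linearB /= !trace_delta_mulmx -{1}vT mxE subrr.
  apply/matrixP => k l; rewrite mxE; have := vT k l.
  by rewrite mulmxBl linearB /= !trace_delta_mulmx; exact: subr0_eq.
have cge : closed [set v : 'rV[R]_(n * n * (n * n)) |
    forall k l, 0 <= vec_mx v k l].
  do 2 apply: closed_forall => ?.
  by under eq_fun do rewrite -trace_delta_mulmx; exact: closed_trace_ge.
have cpsd : closed [set v : 'rV[R]_(n * n * (n * n)) | psd (vec_mx v)].
  apply: closed_forall => x.
  rewrite [X in closed X](_ : _ = [set v | 0 <= \tr (x *m x^T *m vec_mx v)]).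
    exact: closed_trace_ge.
  have trx (M : 'M[R]_(n * n)) : (x^T *m M *m x) 0 0 = \tr (x *m x^T *m M).
    by rewrite -[in RHS]mulmxA mxtrace_mulC /mxtrace big_ord1.
  by apply/seteqP; split=> v /=; rewrite trx.
apply: closedI; first exact: closed_and3.
by apply: closed_and4; do ?[apply: closed_forall => ?]; exact: closed_trace_eq.
Qed.

Lemma SDP2_attained (R : realType) n (r s : 'I_n.+1) (D : 'M[R]_n.+1) :
  SDP2_feasible (R := R) (n := n) !=set0 -> exists v, is_OPT_SDP2 r s D v.
Proof.
case=> Y0 fY0.
have [||v fv vmin] := @compact_EVT_min _ R
  (fun v => \tr (SDP2_cost r s D *m vec_mx v)) _ _ (@SDP2_feasible_compact R n).
- by exists (mxvec Y0); rewrite /= mxvecK.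
- by apply: continuous_subspaceT; exact: continuous_trace_vec_mx.
exists (\tr (SDP2_cost r s D *m vec_mx v)); split.
  by exists (vec_mx v) => //; move: fv; rewrite inE.
by move=> _ [Y fY <-]; rewrite -[Y]mxvecK; apply: vmin; rewrite inE /= mxvecK.
Qed.

(** * The objective in entries, and its value on a triangle *)

(** The first sum prices the cycle edges avoiding [r], halved because ordered pairs count each edge
    twice. The second prices the edges at [r], where [s] is placed. *)
Lemma SDP2_costE (R : realType) n (r s : 'I_n.+1) (D : 'M[R]_n.+1)
    (Y : 'M[R]_(n * n)) :
  \tr (SDP2_cost r s D *m Y) =
  2^-1 * (\sum_u \sum_p \sum_v \sum_q D (lift s u) (lift s v) *
            cycle_adj R n.+1 (lift r p) (lift r q) * ent Y v q u p) +
  \sum_u \sum_p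
    cycle_adj R n.+1 (lift r p) r * D s (lift s u) * ent Y u p u p.
Proof.
rewrite mulmxDl mxtraceD trace_tens_mulmx; congr (_ + _).
  do 4 (rewrite big_distrr /=; apply: eq_bigr => ? _).
  by rewrite 5!mxE; ring.
rewrite /mxtrace sum_mxtens; apply: eq_bigr => u _; apply: eq_bigr => p _.
rewrite mul_diag_mx mxE; congr (_ * _).
by rewrite mxE mxtens_indexK mxE big_ord1 !mxE.
Qed.

Lemma SDP2_feasible_nonempty (R : realType) n :
  SDP2_feasible (R := R) (n := n) !=set0.
Proof.
(* The vectorized identity permutation; [d *m d^T] is the point of the program given by that
   tour. *)
pose d : 'cV[R]_(n * n) :=
  \col_k ((mxtens_unindex k).1 == (mxtens_unindex k).2)%:R.
have dE u p : d (mxtens_index (u, p)) 0 = (u == p)%:R.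
  by rewrite mxE mxtens_indexK.
have dd k l : (d *m d^T) k l = d k 0 * d l 0.
  by rewrite mxE big_ord1 [d^T _ _]mxE.
have d0 k : 0 <= d k 0 by rewrite mxE.
have sumd (F : 'I_n -> R) u : \sum_p (u == p)%:R * F p = F u.
  exact: sum_delta.
exists (d *m d^T); apply/SDP2_feasibleP; split; split.
- by rewrite trmx_mul trmxK.
- by move=> k l; rewrite dd mulr_ge0.
- move=> x; rewrite mulmxA -mulmxA mxE big_ord1.
  by rewrite -[d^T *m x]trmxK trmx_mul trmxK [(_^T) 0 0]mxE -expr2 sqr_ge0.
- move=> p; rewrite -[RHS](sumd (fun=> 1) p); apply: eq_bigr => u _.
  by rewrite dd dE eq_sym -natrM mulnb andbb mulr1.
- move=> u; rewrite -[RHS](sumd (fun=> 1) u); apply: eq_bigr => p _.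
  by rewrite dd dE -natrM mulnb andbb mulr1.
- move=> u p v q; rewrite dd !dE -natrM mulnb.
  by case: (u =P p) => [<-|]; case: (v =P q) => [<-|]; rewrite ?eqxx.
have sum1 : \sum_k d k 0 = n%:R.
  rewrite sum_mxtens -[n in RHS]card_ord -sumr_const; apply: eq_bigr => u _.
  rewrite -[RHS](sumd (fun=> 1) u); apply: eq_bigr => p _.
  by rewrite dE mulr1.
rewrite expr2 -{1}sum1 mulr_suml; apply: eq_bigr => k _.
by rewrite -sum1 mulr_sumr; apply: eq_bigr => l _; rewrite dd.
Qed.

Lemma cycle_adj3 (R : realType) (i j : 'I_3) : cycle_adj R 3 i j = (i != j)%:R.
Proof.
by rewrite mxE; case: i => [[|[|[|//]]] ?]; case: j => [[|[|[|//]]] ?].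
Qed.

(** The 3-cycle is complete, so by (ii) the linear part is the sum of the two distances from [s]. In
    the quadratic part only entries with [u != v] and [p != q] count; they add up to 2, the total 4
    of (iv) minus the diagonal total 2, and the factor 1/2 leaves the third side. *)
Lemma SDP2_triangle (R : realType) (r s : 'I_3) (D : 'M[R]_3) Y :
  tsp_instance D -> SDP2_feasible Y ->
  \tr (SDP2_cost r s D *m Y) = D 0 1 + D 1 2%:R + D 2%:R 0.
Proof.
case=> _ DT _ D0 _ /SDP2_feasibleP[_ [h1 h2 h3 h4]].
have Dsym i j : D i j = D j i by rewrite -{1}DT mxE.
transitivity (D (lift s 0) (lift s 1) + D s (lift s 0) + D s (lift s 1)).
  rewrite SDP2_costE; under [in X in _ + X]eq_bigr => u _.
    under eq_bigr => p _ do rewrite cycle_adj3 eq_sym neq_lift mul1r.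
    rewrite -mulr_sumr h2 mulr1; over.
  have l10 : lift ord0 ord0 = 1 :> 'I_2 by apply/val_inj.
  have o0 : ord0 = 0 :> 'I_2 by [].
  have {h4} : \sum_u \sum_p \sum_v \sum_q ent Y u p v q = 2%:R ^+ 2.
    rewrite -h4 sum_mxtens; apply: eq_bigr => u _; apply: eq_bigr => p _.
    by rewrite sum_mxtens.
  move: (h1 1) (h1 0).
  rewrite !(big_ord_recl, big_ord0) /= !cycle_adj3 !(inj_eq (@lift_inj _ _)) /=.
  rewrite !l10 !o0 !D0 (Dsym (lift s 1) (lift s 0)).
  (* The eight entries killed by (iii), out of sixteen. *)
  have h := (h3 0 0 0 1 isT, h3 0 1 0 0 isT, h3 1 0 1 1 isT, h3 1 1 1 0 isT,
           h3 0 0 1 0 isT, h3 1 0 0 0 isT, h3 0 1 1 1 isT, h3 1 1 0 1 isT).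
  rewrite !h => sum1 sum0 sumY.
  have -> : ent Y 1 1 0 0 =
      2%:R - ent Y 0 1 1 0 - ent Y 1 0 0 1 - ent Y 0 0 1 1 by lra.
  by lra.
have o1 : lift 0 0 = 1 :> 'I_3 by apply/val_inj.
have o2 : lift 0 1 = 2%:R :> 'I_3 by apply/val_inj.
have o3 : lift 1 0 = 0 :> 'I_3 by apply/val_inj.
have o4 : lift 1 1 = 2%:R :> 'I_3 by apply/val_inj.
have o5 : lift 2%:R 0 = 0 :> 'I_3 by apply/val_inj.
have o6 : lift 2%:R 1 = 1 :> 'I_3 by apply/val_inj.
have : [\/ s = 0, s = 1 | s = 2%:R].
  by case: s => [[|[|[|//]]] ?]; [apply: Or31|apply: Or32|apply: Or33];
    apply/val_inj.
have d1 := Dsym 0 1; have d2 := Dsym 1 2%:R; have d3 := Dsym 0 2%:R.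
by case=> ->; rewrite ?(o1, o2, o3, o4, o5, o6); lra.
Qed.

(** * Positive semidefinite matrices and graph Laplacians *)

Section Psd.
Variable R : realType.

Lemma psdE n (Y : 'M[R]_n) (x : 'cV[R]_n) :
  (x^T *m Y *m x) 0 0 = \sum_k \sum_l x k 0 * Y k l * x l 0.
Proof.
rewrite mxE exchange_big; apply: eq_bigr => l _ /=; rewrite mxE mulr_suml.
by apply: eq_bigr => k _; rewrite mxE.
Qed.

Lemma psdD n (A B : 'M[R]_n) : psd A -> psd B -> psd (A + B).
Proof.
by move=> pA pB x; rewrite mulmxDr mulmxDl mxE addr_ge0 ?pA ?pB.
Qed.

Lemma psd_sum n (I : finType) (A : I -> 'M[R]_n) :
  (forall i, psd (A i)) -> psd (\sum_i A i).
Proof.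
move=> pA; elim/big_ind: _ => //; last exact: psdD.
by move=> x; rewrite mulmx0 mul0mx mxE.
Qed.

Lemma psdZ n a (A : 'M[R]_n) : 0 <= a -> psd A -> psd (a *: A).
Proof.
by move=> a0 pA x; rewrite -scalemxAr -scalemxAl mxE mulr_ge0 ?pA.
Qed.

Lemma psd_congr m n (V : 'M[R]_(m, n)) (A : 'M[R]_m) :
  psd A -> psd (V^T *m A *m V).
Proof.
by move=> pA x; have := pA (V *m x); rewrite trmx_mul !mulmxA.
Qed.

(** The diagonal of [W] cancels, so weights with a nonzero diagonal, such as [class_mx] and
    [class_pair], are allowed. *)
Definition laplacian n (W : 'M[R]_n) : 'M[R]_n :=
  diag_mx (\row_i \sum_j W i j) - W.

Lemma laplacianE n (W : 'M[R]_n) i j :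
  laplacian W i j = (\sum_k W i k) *+ (i == j) - W i j.
Proof. by rewrite !mxE. Qed.

Lemma laplacian_row n (W : 'M[R]_n) i : \sum_j laplacian W i j = 0.
Proof.
under eq_bigr => j _ do rewrite laplacianE -mulr_natl.
by rewrite sumrB sum_delta subrr.
Qed.

(** The Dirichlet form identity, for an arbitrary array [b] instead of products [x i * x j], so that
    it also applies when [b] is a bilinear form evaluated at slices of a vector. *)
Lemma laplacian_form n (W : 'M[R]_n) (b : 'I_n -> 'I_n -> R) : W^T = W ->
  \sum_i \sum_j laplacian W i j * b i j =
  2^-1 * \sum_i \sum_j W i j * (b i i + b j j - b i j - b j i).
Proof.
move=> WT; have Wsym i j : W i j = W j i by rewrite -{1}WT mxE.
pose S := \sum_i \sum_j W i j * b i i; pose T := \sum_i \sum_j W i j * b i j.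
have ST : \sum_i \sum_j W i j * b j j = S.
  rewrite exchange_big; apply: eq_bigr => i _; apply: eq_bigr => j _.
  by rewrite Wsym.
have TT : \sum_i \sum_j W i j * b j i = T.
  rewrite exchange_big; apply: eq_bigr => i _; apply: eq_bigr => j _.
  by rewrite Wsym.
transitivity (S - T).
  rewrite -sumrB; apply: eq_bigr => i _.
  under eq_bigr => j _ do rewrite laplacianE mulrBl -mulr_natl -mulrA.
  by rewrite sumrB sum_delta mulr_suml.
have -> : \sum_i \sum_j W i j * (b i i + b j j - b i j - b j i) =
    S + S - T - T.
  rewrite -{2}ST -{2}TT -!(sumrB, big_split) /=; apply: eq_bigr => i _.
  rewrite -!(sumrB, big_split) /=; apply: eq_bigr => j _; ring.
by field.
Qed.

(* Expanding only the Laplacian factor, the form at [x] is a nonnegative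
   combination of the values of [L] at the differences of slices of [x]. *)
Lemma psd_tens_laplacian m n (W : 'M[R]_m) (L : 'M[R]_n) :
  W^T = W -> (forall i j, 0 <= W i j) -> psd L -> psd (laplacian W *t L).
Proof.
move=> WT W0 pL x.
pose b u v := \sum_p \sum_q
  x (mxtens_index (u, p)) 0 * L p q * x (mxtens_index (v, q)) 0.
suff -> : (x^T *m (laplacian W *t L) *m x) 0 0 =
    \sum_u \sum_v laplacian W u v * b u v.
  rewrite laplacian_form //; apply: mulr_ge0; first by rewrite invr_ge0.
  apply: sumr_ge0 => u _; apply: sumr_ge0 => v _; apply: mulr_ge0 => //.
  have := pL (\col_p (x (mxtens_index (u, p)) 0 - x (mxtens_index (v, p)) 0)).
  rewrite psdE -!(sumrB, big_split) /=; congr (0 <= _); apply: eq_bigr => p _.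
  rewrite -!(sumrB, big_split) /=; apply: eq_bigr => q _; rewrite !mxE; ring.
rewrite psdE sum_mxtens; apply: eq_bigr => u _.
under eq_bigr => p _ do rewrite sum_mxtens.
rewrite exchange_big; apply: eq_bigr => v _ /=; rewrite mulr_sumr.
apply: eq_bigr => p _; rewrite mulr_sumr; apply: eq_bigr => q _.
by rewrite tensmxE; ring.
Qed.

Lemma psd_laplacian n (W : 'M[R]_n) :
  W^T = W -> (forall i j, 0 <= W i j) -> psd (laplacian W).
Proof.
move=> WT W0 x; rewrite psdE.
have -> : \sum_k \sum_l x k 0 * laplacian W k l * x l 0 =
    \sum_k \sum_l laplacian W k l * (x k 0 * x l 0).
  by apply: eq_bigr => k _; apply: eq_bigr => l _; ring.
rewrite laplacian_form //; apply: mulr_ge0; first by rewrite invr_ge0.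
apply: sumr_ge0 => u _; apply: sumr_ge0 => v _; apply: mulr_ge0 => //.
have -> : forall y z : R, y * y + z * z - y * z - z * y = (y - z) ^+ 2.
  by move=> y z; ring.
exact: sqr_ge0.
Qed.

End Psd.

(** * Cut metrics *)

Definition cut_metric (R : realType) n (col : 'I_n -> bool) : 'M[R]_n :=
  \matrix_(i, j) (col i != col j)%:R.

Lemma cut_metric_tsp (R : realType) n (col : 'I_n -> bool) :
  (3 <= n)%N -> tsp_instance (cut_metric R col).
Proof.
move=> n3; split=> // [|i j|i|i j k]; last 1 first.
- by rewrite !mxE -natrD ler_nat; case: (col i) (col j) (col k) => -[] [].
- by apply/matrixP => i j; rewrite !mxE eq_sym.
- by rewrite mxE.
by rewrite mxE eqxx.
Qed.

(** * Feasible points from pair moments of a two-class placement *)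

Section TwoClasses.
Variables (R : realType) (n : nat) (c : 'I_n -> bool) (M : 'M[R]_n).

Let N a : R := \sum_u (c u == a)%:R.

(** The hypotheses on [M] hold for the pair moments of a random set of exactly [N true] positions:
    [M_row] and [M_trace] express its constant size, while [M_le] and [M_union] say that exactly one
    given position, or neither of two, is occupied with nonnegative probability. *)
Hypothesis N_gt1 : forall a, 1 < N a.
Hypothesis M_sym : M^T = M.
Hypothesis M_psd : psd M.
Hypothesis M_row : forall p, \sum_q M p q = N true * M p p.
Hypothesis M_trace : \tr M = N true.
Hypothesis M_ge0 : forall p q, 0 <= M p q.
Hypothesis M_le : forall p q, M p q <= M p p.
Hypothesis M_union : forall p q, M p p + M q q - M p q <= 1.

(* If [xi] is the indicator of a random set of positions with pair moments [M],
   then [class_pair a b p q] is the probability of [xi p = a] and [xi q = b]. *)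
Definition class_pair a b : 'M[R]_n := \matrix_(p, q)
  match a, b with
  | true, true => M p q
  | true, false => M p p - M p q
  | false, true => M q q - M p q
  | false, false => 1 - M p p - M q q + M p q
  end.

Definition class_mx a : 'M[R]_n := \matrix_(u, v) ((c u == a) && (c v == a))%:R.

(* Expresses [xi p / N true] and [(1 - xi p) / N false] as linear forms in [xi],
   the constant 1 being written [(\sum_r xi r) / N true]. *)
Definition two_class_lift : 'M[R]_(n, n * n) := \matrix_(r, k)
  let: (u, p) := mxtens_unindex k in
  if c u then (r == p)%:R / N true
  else (N true)^-1 / N false - (r == p)%:R / N false.

(* The lift alone spreads [class_pair] over the classes, wrongly putting mass on
   (u, p), (u, q) and on (u, p), (v, p); the Laplacian terms move it away
   without changing the sum over a class. *)
Definition two_class_sol : 'M[R]_(n * n) :=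
  two_class_lift^T *m M *m two_class_lift +
  \sum_(a : bool) (N a ^+ 2 * (N a - 1))^-1 *:
    (laplacian (class_mx a) *t laplacian (class_pair a a)).

Let Msym p q : M p q = M q p. Proof. by rewrite -{1}M_sym mxE. Qed.

Let N_neq0 a : N a != 0.
Proof. by rewrite gt_eqF // (lt_trans ltr01) ?N_gt1. Qed.

Let N1_neq0 a : N a - 1 != 0.
Proof. by rewrite subr_eq0 gt_eqF ?N_gt1. Qed.

Let sum_class (F : bool -> R) :
  \sum_u F (c u) = N true * F true + N false * F false.
Proof.
rewrite /N !mulr_suml -big_split /=; apply: eq_bigr => u _.
by case: (c u); rewrite ?mul1r ?mul0r ?addr0 ?add0r.
Qed.

Let NN : N true + N false = n%:R.
Proof.
have := sum_class (fun=> 1); rewrite !mulr1 => <-.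
by rewrite sumr_const card_ord.
Qed.

Lemma class_pair_ge0 a b p q : 0 <= class_pair a b p q.
Proof.
rewrite mxE; case: a b => -[] //; last by have := M_union p q; lra.
  by rewrite subr_ge0.
by rewrite subr_ge0 Msym.
Qed.

Lemma class_pair_tr a b p q : class_pair a b p q = class_pair b a q p.
Proof. by rewrite !mxE (Msym q p); case: a b => -[] //; ring. Qed.

Lemma class_pair_diag a b p : a != b -> class_pair a b p p = 0.
Proof. by rewrite mxE; case: a b => -[] //; rewrite subrr. Qed.

(** Class [a] always occupies [N a] positions, by [M_row] and [M_trace]. These row sums give the
    diagonal of [laplacian (class_pair a a)]. *)
Lemma class_pair_row a p : \sum_q class_pair a a p q = N a * class_pair a a p p.
Proof.
rewrite mxE; under eq_bigr do rewrite mxE.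
case: a => //; rewrite big_split sumrB /= M_row sumr_const card_ord -/(\tr M).
by rewrite M_trace -mulr_natl -NN; ring.
Qed.

Lemma class_pair_sum p q :
  class_pair true true p q + class_pair true false p q +
  class_pair false true p q + class_pair false false p q = 1.
Proof. by rewrite !mxE; ring. Qed.

Lemma class_pair_trace a : \sum_p class_pair a a p p = N a.
Proof.
under eq_bigr do rewrite mxE; case: a => //.
under eq_bigr do rewrite subrK.
by rewrite sumrB sumr_const card_ord -/(\tr M) M_trace -NN; ring.
Qed.

(** Each application of the lift turns one index of [M] from an occupied position into a vertex of
    either class, dividing by the class size. For the class [false], [M_row] makes the rewritten
    constant 1 act as a constant. *)
Let ent_split u p v q :
  ent two_class_sol u p v q =
  class_pair (c u) (c v) p q / (N (c u) * N (c v)) +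
  \sum_(a : bool) (N a ^+ 2 * (N a - 1))^-1 *
    (laplacian (class_mx a) u v * laplacian (class_pair a a) p q).
Proof.
rewrite [two_class_sol _ _]mxE summxE; congr (_ + _); last first.
  by apply: eq_bigr => a _; rewrite mxE tensmxE.
have MV r v' q' : (M *m two_class_lift) r (mxtens_index (v', q')) =
    class_pair true (c v') r q' / N (c v').
  rewrite mxE; case cv: (c v').
    transitivity (\sum_t (q' == t)%:R * (M r t / N true)).
      apply: eq_bigr => t _; rewrite [two_class_lift _ _]mxE mxtens_indexK cv.
      by rewrite eq_sym; ring.
    by rewrite sum_delta mxE.
  transitivity (\sum_t M r t * ((N true)^-1 / N false) -
                \sum_t (q' == t)%:R * (M r t / N false)).
    rewrite -sumrB; apply: eq_bigr => t _.
    by rewrite [two_class_lift _ _]mxE mxtens_indexK cv eq_sym; ring.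
  by rewrite sum_delta -mulr_suml M_row mxE; field; rewrite !N_neq0.
rewrite -mulmxA mxE; under eq_bigr => t _ do rewrite MV.
case cu: (c u).
  transitivity (\sum_t (p == t)%:R *
      (class_pair true (c v) t q / N (c v) / N true)).
    apply: eq_bigr => t _; rewrite [two_class_lift^T _ _]mxE.
    by rewrite [two_class_lift _ _]mxE mxtens_indexK cu eq_sym; ring.
  by rewrite sum_delta; field; rewrite !N_neq0.
transitivity (
    (\sum_t class_pair true (c v) t q) / (N (c v) * N true * N false) -
    \sum_t (p == t)%:R * (class_pair true (c v) t q / N (c v) / N false)).
  rewrite mulr_suml -sumrB; apply: eq_bigr => t _.
  rewrite [two_class_lift^T _ _]mxE [two_class_lift _ _]mxE mxtens_indexK cu.
  rewrite eq_sym.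
  by field; rewrite !N_neq0.
rewrite sum_delta; have -> : \sum_t class_pair true (c v) t q =
    N true * (if c v then M q q else 1 - M q q).
  under eq_bigr => t _ do rewrite mxE.
  case: (c v).
    by under eq_bigr => t _ do rewrite Msym; rewrite M_row.
  rewrite sumrB -/(\tr M) M_trace mulrBr mulr1 -M_row.
  by under [X in _ - X = _]eq_bigr => t _ do rewrite Msym.
by rewrite !mxE; case: (c v); field; rewrite !N_neq0.
Qed.

(** These are the pair probabilities when the positions of each class are matched to its vertices by
    a uniform random bijection. The weight [(N a ^+ 2 * (N a - 1))^-1] is the one cancelling the
    entries with [u = v], [p != q] and, within a class, those with [u != v], [p = q]. *)
Lemma two_class_solE u p v q :
  ent two_class_sol u p v q =
  if u == v then (p == q)%:R * class_pair (c u) (c u) p q / N (c u)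
  else if c u == c v then
    (p != q)%:R * class_pair (c u) (c u) p q / (N (c u) * (N (c u) - 1))
  else class_pair (c u) (c v) p q / (N true * N false).
Proof.
have row_mx a w : \sum_w' class_mx a w w' = (c w == a)%:R * N a.
  by rewrite mulr_sumr; apply: eq_bigr => w' _; rewrite mxE -mulnb natrM.
have lapE a : laplacian (class_mx a) u v * laplacian (class_pair a a) p q =
    ((c u == a)%:R * N a *+ (u == v) - ((c u == a) && (c v == a))%:R) *
    (N a * class_pair a a p p *+ (p == q) - class_pair a a p q).
  by rewrite !laplacianE row_mx class_pair_row [class_mx _ _ _]mxE.
rewrite ent_split big_bool /= !lapE.
have dtf p1 : class_pair true false p1 p1 = 0 by exact: class_pair_diag.
have dft p1 : class_pair false true p1 p1 = 0 by exact: class_pair_diag.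
case: (eqVneq u v) => [<-|_]; case: (eqVneq p q) => [<-|_];
  case: (c u); try case: (c v); rewrite /= ?dtf ?dft ?(mulr1n, mulr0n);
  by field; rewrite ?N_neq0 ?N1_neq0.
Qed.

Lemma two_class_sol_psd : psd two_class_sol.
Proof.
apply: psdD; first exact: psd_congr.
apply: psd_sum => a; apply: psdZ.
  by rewrite invr_ge0 mulr_ge0 ?sqr_ge0 // subr_ge0 ltW ?N_gt1.
apply: psd_tens_laplacian.
- by apply/matrixP => u v; rewrite !mxE andbC.
- by move=> u v; rewrite mxE.
apply: psd_laplacian; last exact: class_pair_ge0.
by apply/matrixP => p q; rewrite mxE class_pair_tr.
Qed.

Let ent_diag u p :
  ent two_class_sol u p u p = class_pair (c u) (c u) p p / N (c u).
Proof. by rewrite two_class_solE !eqxx mul1r. Qed.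

Lemma two_class_sol_feasible : SDP2_feasible two_class_sol.
Proof.
apply/SDP2_feasibleP; split; split.
- apply/matrixP => k l; rewrite mxE -(mxtens_unindexK k) -(mxtens_unindexK l).
  case: (mxtens_unindex k) => u p; case: (mxtens_unindex l) => v q.
  rewrite !two_class_solE (eq_sym v) (eq_sym q) (eq_sym (c v)).
  case: (eqVneq u v) => [<-|_]; first by rewrite (class_pair_tr _ _ q p).
  by case: (eqVneq (c u) (c v)) => [<-|_]; rewrite (class_pair_tr _ _ q p).
- move=> k l; rewrite -(mxtens_unindexK k) -(mxtens_unindexK l).
  case: (mxtens_unindex k) => u p; case: (mxtens_unindex l) => v q.
  have N_ge0 a : 0 <= N a by rewrite ltW // (lt_trans ltr01) ?N_gt1.
  have N1_ge0 a : 0 <= N a - 1 by rewrite subr_ge0 ltW ?N_gt1.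
  rewrite two_class_solE; do ?case: ifP => _;
    by rewrite !(mulr_ge0, invr_ge0, class_pair_ge0).
- exact: two_class_sol_psd.
- move=> p; under eq_bigr do rewrite ent_diag.
  rewrite (sum_class (fun a => class_pair a a p p / N a)) !mxE.
  by field; rewrite !N_neq0.
- move=> u; under eq_bigr do rewrite ent_diag.
  by rewrite -mulr_suml class_pair_trace divff.
- move=> u p v q; rewrite two_class_solE.
  case: (eqVneq u v) => [_|_]; case: (eqVneq p q) => [<-|_] //= _.
    by rewrite !mul0r.
  case: (eqVneq (c u) (c v)) => [_|cuv]; first by rewrite !mul0r.
  by rewrite class_pair_diag // mul0r.
(* For (iv), each pair of positions carries total mass 1: the Laplacian terms have zero row sums,
   and the spread [class_pair] sums to the total probability. *)
have sum_uv p q : \sum_u \sum_v ent two_class_sol u p v q = 1.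
  under eq_bigr => u _ do under eq_bigr => v _ do rewrite ent_split.
  under eq_bigr => u _ do rewrite big_split exchange_big /=.
  rewrite big_split /= [X in _ + X]big1 ?addr0 => [|u _]; last first.
    apply: big1 => a _; rewrite -mulr_sumr -mulr_suml laplacian_row.
    by rewrite mul0r mulr0.
  under eq_bigr => u _ do
    rewrite (sum_class (fun b => class_pair (c u) b p q / (N (c u) * N b))).
  rewrite (sum_class (fun a =>
    N true * (class_pair a true p q / (N a * N true)) +
    N false * (class_pair a false p q / (N a * N false)))).
  by rewrite -(class_pair_sum p q); field; rewrite !N_neq0.
rewrite sum_mxtens exchange_big /=.
transitivity (\sum_(p < n) \sum_(q < n) (1 : R)); last first.
  by rewrite !sumr_const !card_ord -mulrnA mulnn natrX.
apply: eq_bigr => p _; under eq_bigr => u _ do rewrite sum_mxtens exchange_big.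
by rewrite exchange_big; apply: eq_bigr => q _; exact: sum_uv.
Qed.

(** The cost is the expected number of cycle edges joining the classes. [M p p + M q q - M p q *+ 2]
    is the probability that [p] and [q] lie in different classes, and an edge at [r] is cut when its
    other end is outside the class of [s]. *)
Lemma two_class_sol_cut_cost (r s : 'I_n.+1) (col : 'I_n.+1 -> bool) :
  col s = true -> (forall u, col (lift s u) = c u) ->
  \tr (SDP2_cost r s (cut_metric R col) *m two_class_sol) =
  2^-1 * (\sum_p \sum_q cycle_adj R n.+1 (lift r p) (lift r q) *
            (M p p + M q q - M p q *+ 2)) +
  \sum_p cycle_adj R n.+1 (lift r p) r * (1 - M p p).
Proof.
move=> cols colc; rewrite SDP2_costE; congr (_ * _ + _).
  rewrite exchange_big; apply: eq_bigr => p _ /=.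
  under eq_bigr => u _ do rewrite exchange_big.
  rewrite exchange_big; apply: eq_bigr => q _ /=.
  pose F a b := (a != b)%:R * class_pair b a q p / (N true * N false).
  transitivity (cycle_adj R n.+1 (lift r p) (lift r q) *
                \sum_u \sum_v F (c u) (c v)).
    rewrite mulr_sumr; apply: eq_bigr => u _; rewrite mulr_sumr.
    apply: eq_bigr => v _; rewrite two_class_solE mxE !colc /F [c v == _]eq_sym.
    case: (eqVneq v u) => [->|_]; first by rewrite eqxx !(mul0r, mulr0).
    by case: (eqVneq (c u) (c v)) => _ /=; ring.
  congr (_ * _); under eq_bigr => u _ do rewrite (sum_class (F (c u))).
  rewrite (sum_class (fun a => N true * F a true + N false * F a false)).
  by rewrite /F /= !mxE (Msym q p); field; rewrite !N_neq0.
rewrite exchange_big; apply: eq_bigr => p _ /=.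
pose F a := (true != a)%:R * (class_pair a a p p / N a).
transitivity (cycle_adj R n.+1 (lift r p) r * \sum_u F (c u)).
  rewrite mulr_sumr; apply: eq_bigr => u _.
  by rewrite ent_diag [cut_metric _ _ _ _]mxE cols colc /F; ring.
by rewrite sum_class; congr (_ * _); rewrite /F /= !mxE; field; rewrite !N_neq0.
Qed.

End TwoClasses.

Lemma psd_mxsub (R : realType) m n (f : 'I_n -> 'I_m) (A : 'M[R]_m) :
  psd A -> psd (mxsub f f A).
Proof.
move=> pA; pose V : 'M[R]_(m, n) := colsub f 1%:M.
suff -> : mxsub f f A = V^T *m A *m V by exact: psd_congr.
rewrite trmx_mxsub trmx1 mul_rowsub_mx mul1mx mulmx_colsub mulmx1.
by rewrite -mxsub_comp.
Qed.

(** * The seven-vertex instance and its value 7/4 *)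

Section Gap.
Variable R : realType.

(* Read off a numerical optimum of the program over pair moments. *)
Definition six_moments : 'M[R]_6 := \matrix_(p, q)
  ((nth 0 (nth [::] [:: [:: 6; 4; 1; 0; 2; 5];
                        [:: 4; 4; 2; 0; 0; 2];
                        [:: 1; 2; 2; 1; 0; 0];
                        [:: 0; 0; 1; 2; 2; 1];
                        [:: 2; 0; 0; 2; 4; 4];
                        [:: 5; 2; 0; 1; 4; 6]] p) q)%N%:R / 8%:R).

Lemma six_moments_psd : psd six_moments.
Proof.
move=> x; rewrite psdE !(big_ord_recl, big_ord0).
have [x0 [x1 [x2 [x3 [x4 [x5 ->]]]]]] : exists x0 x1 x2 x3 x4 x5 : R,
    x = \col_i nth 0 [:: x0; x1; x2; x3; x4; x5] i.
  exists (x 0 0), (x 1 0), (x 2%:R 0), (x 3%:R 0), (x 4%:R 0), (x 5%:R 0).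
  apply/colP => i; rewrite mxE; case: i => [[|[|[|[|[|[|//]]]]]] ?] /=;
    by congr (x _ _); do ?apply/val_inj.
rewrite !mxE /=.
(* The table is symmetric under reversing the positions, which splits the form
   into its even and odd parts, of ranks 2 and 1. *)
suff : 0 <= 8%:R^-1 * (2^-1 * (3 * (x0 + x5) + 2 * (x1 + x4) + (x2 + x3)) ^+ 2 +
    (x0 + x5 - x2 - x3) ^+ 2 +
    2^-1 * ((x0 - x5) + 2 * (x1 - x4) + (x2 - x3)) ^+ 2).
  by congr (0 <= _); field.
by do ?[exact: sqr_ge0|apply: addr_ge0|apply: mulr_ge0]; rewrite invr_ge0.
Qed.

Lemma six_moments_bounds p q :
  [/\ six_moments p q = six_moments q p, 0 <= six_moments p q,
      six_moments p q <= six_moments p p &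
      six_moments p p + six_moments q q - six_moments p q <= 1].
Proof.
rewrite !mxE; case: p => [[|[|[|[|[|[|//]]]]]] ?];
  by case: q => [[|[|[|[|[|[|//]]]]]] ?]; split=> //=; lra.
Qed.

Lemma six_moments_row p : \sum_q six_moments p q = 3%:R * six_moments p p.
Proof.
rewrite !(big_ord_recl, big_ord0) !mxE.
by case: p => [[|[|[|[|[|[|//]]]]]] ?] /=; lra.
Qed.

Lemma six_moments_trace : \tr six_moments = 3%:R.
Proof. by rewrite /mxtrace !(big_ord_recl, big_ord0) !mxE /=; lra. Qed.

(* Position along the cycle, with 0 for the successor of [r]; subtraction is
   modulo 6. *)
Definition offset (r : 'I_7) (p : 'I_6) : 'I_6 := p - inZp r.

Lemma offset_inj r : injective (offset r).
Proof. by move=> p q /addIr. Qed.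

(** Deleting [r] from the 7-cycle leaves a path, along which [offset r] numbers the vertices in
    order. The finitely many cases are checked by computation. *)
Lemma cycle_adj_offset r p q :
  cycle_adj R 7 (lift r p) (lift r q) =
  ((offset r p == (offset r q).+1 :> nat) ||
   (offset r q == (offset r p).+1 :> nat))%:R.
Proof.
rewrite mxE; congr (_%:R); move: r p q.
case=> [[|[|[|[|[|[|[|//]]]]]]] ?]; case=> [[|[|[|[|[|[|//]]]]]] ?];
  by case=> [[|[|[|[|[|[|//]]]]]] ?].
Qed.

Lemma cycle_adj_offset_end r p :
  cycle_adj R 7 (lift r p) r =
  ((offset r p == 0 :> nat)%N || (offset r p == 5 :> nat)%N)%:R.
Proof.
rewrite mxE; congr (_%:R); move: r p.
by case=> [[|[|[|[|[|[|[|//]]]]]]] ?]; case=> [[|[|[|[|[|[|//]]]]]] ?].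
Qed.

(** Transporting the table along [offset r] handles every [r] at once. *)
Lemma SDP2_gap (r s : 'I_7) (col : 'I_7 -> bool) :
  col s = true -> (forall u : 'I_6, col (lift s u) = (u < 3)%N) ->
  SDP2_values r s (cut_metric R col) (7%:R / 4%:R).
Proof.
move=> cols colE; pose c (u : 'I_6) := (u < 3)%N.
pose M := mxsub (offset r) (offset r) six_moments.
have N3 a : \sum_u (c u == a)%:R = 3%:R :> R.
  by rewrite !(big_ord_recl, big_ord0) /=; case: a => /=; lra.
have N_gt1 a : 1 < \sum_u (c u == a)%:R :> R by rewrite N3 ltr1n.
have ME p q : M p q = six_moments (offset r p) (offset r q) by exact: mxE.
have M_bounds p q := six_moments_bounds (offset r p) (offset r q).
have M_sym : M^T = M.
  by apply/matrixP => p q; rewrite [LHS]mxE !ME; case: (M_bounds p q).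
have M_psd : psd M by apply: psd_mxsub; exact: six_moments_psd.
have M_row p : \sum_q M p q = (\sum_u (c u == true)%:R) * M p p.
  rewrite N3 ME -six_moments_row [RHS](reindex_inj (@offset_inj r)).
  by apply: eq_bigr => q _; rewrite ME.
have M_trace : \tr M = \sum_u (c u == true)%:R.
  rewrite N3 -six_moments_trace /mxtrace [RHS](reindex_inj (@offset_inj r)).
  by apply: eq_bigr => q _; rewrite ME.
have M_ge0 p q : 0 <= M p q by rewrite ME; case: (M_bounds p q).
have M_le p q : M p q <= M p p by rewrite !ME; case: (M_bounds p q).
have M_union p q : M p p + M q q - M p q <= 1.
  by rewrite !ME; case: (M_bounds p q).
exists (two_class_sol c M); first exact: two_class_sol_feasible.
rewrite (two_class_sol_cut_cost N_gt1 M_sym) //.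
pose A (i j : 'I_6) : R := ((i == j.+1 :> nat) || (j == i.+1 :> nat))%:R.
pose E (i : 'I_6) : R := ((i == 0 :> nat)%N || (i == 5 :> nat)%N)%:R.
pose m := six_moments.
transitivity (2^-1 * (\sum_i \sum_j A i j * (m i i + m j j - m i j *+ 2)) +
              \sum_i E i * (1 - m i i)).
  congr (_ * _ + _); rewrite [RHS](reindex_inj (@offset_inj r)); last first.
    by apply: eq_bigr => p _; rewrite cycle_adj_offset_end ME.
  apply: eq_bigr => p _; rewrite [RHS](reindex_inj (@offset_inj r)).
  by apply: eq_bigr => q _; rewrite cycle_adj_offset !ME.
(* Each of the five path edges and the two edges at [r] is cut with pseudo-probability 1/4, hence
   7/4. *)
by rewrite !(big_ord_recl, big_ord0) /A /E /m !mxE /=; lra.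
Qed.

End Gap.

Theorem corollary4p22 (R : realType) (r s : forall n : nat, 'I_n.+1) :
  exists (n n' : nat) (D : 'M[R]_n.+1) (D' : 'M[R]_n'.+1),
    [/\ (n.+1 < n'.+1)%N,
        tsp_instance D,
        tsp_instance D',
        exists2 f : 'I_n.+1 -> 'I_n'.+1, injective f & D = mxsub f f D'
      & exists opt opt' : R,
          [/\ is_OPT_SDP2 (r n) (s n) D opt,
              is_OPT_SDP2 (r n') (s n') D' opt'
            & opt' < opt]].
Proof.
pose col i := if unlift (s 6) i is Some u then (u < 3)%N else true.
have cols : col (s 6) = true by rewrite /col unlift_none.
have colE (u : 'I_6) : col (lift (s 6) u) = (u < 3)%N by rewrite /col liftK.
(* The triangle consists of the vertices [lift (s 6) u] for [u] equal to 1, 2, 3: two in the class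
   of [s 6] and one outside, so its sides are 0, 1, 1. *)
pose f (i : 'I_3) := lift (s 6) (rshift 1 (widen_ord (isT : (3 <= 5)%N) i)).
have f_inj : injective f.
  by move=> i j /lift_inj/rshift_inj/(congr1 val) ij; exact/val_inj.
have tspD : tsp_instance (cut_metric R (col \o f)) by exact: cut_metric_tsp.
exists 2, 6, (cut_metric R (col \o f)), (cut_metric R col); split=> //.
- exact: cut_metric_tsp.
- by exists f => //; apply/matrixP => i j; rewrite !mxE.
have [opt [[Y fY Yopt] optP]] :=
  SDP2_attained (r 2) (s 2) (cut_metric R (col \o f))
  (SDP2_feasible_nonempty R 2).
have [opt' opt'P] := SDP2_attained (r 6) (s 6) (cut_metric R col)
  (SDP2_feasible_nonempty R 6).
exists opt, opt'; split=> //; first by split=> //; exists Y.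
have opt'_le : opt' <= 7%:R / 4%:R.
  by case: opt'P => _; apply; exact: SDP2_gap.
apply: (le_lt_trans opt'_le).
(* The small optimum is the perimeter 2, which exceeds 7/4. *)
rewrite -Yopt SDP2_triangle // !mxE /= !colE /=.
by lra.
Qed.
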